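(* For every r.e. Turing degree $\mathbf{d}$ with $\mathbf{0}<\mathbf{d}\leq\mathbf{0}'$ one can effectively find a theory $U_{\mathbf{d}}$ in propositional logic which has Turing degree $\mathbf{d}$, is Turing persistent, and for which $\mathsf{G1}$ holds (every consistent r.e. extension of $U_{\mathbf{d}}$ is incomplete).
   Context: Propositional logic here has countably many propositional variables $\{p_n:n\in\omega\}$; a theory is a set of propositional formulas, identified with its set of consequences (coded by Gödel numbers). A theory $S$ is complete if for every formula $\phi$, $S\vdash\phi$ or $S\vdash\neg\phi$. An r.e. theory $U$ is Turing persistent if for every consistent r.e. theory $V\supseteq U$, $U\leq_T V$. ''Effectively'' means there is a recursive function $f$ such that if $W_e$ is non-recursive of degree $\mathbf{d}$ then $f(e)$ is an index of such a theory. *)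

(* Defs.v *)
From Stdlib Require Import Arith.
From Stdlib Require Cantor.

(** * Oracle computability *)

(** Mu-recursive functions relative to an oracle.  All functions are unary; an
    n-ary function is a unary one on Cantor-coded tuples. *)
Inductive prog : Type :=
| PZero | PSucc | PFst | PSnd | POracle
| PPair (c d : prog)
| PComp (d c : prog)    (* first [c], then [d] *)
| PRec (c d : prog)     (* primitive recursion on the second component *)
| PMin (c : prog).      (* unbounded minimisation *)

Definition nat_set := nat -> Prop.

(** Graph of the function [h] with [h a 0 = c a] and
    [h a (n+1) = d <a, <n, h a n>>]. *)
Fixpoint prim_rec (c d : nat -> nat -> Prop) (a n y : nat) : Prop :=
  match n with
  | 0 => c a y
  | S m => exists r, prim_rec c d a m r
                     /\ d (Cantor.to_nat (a, Cantor.to_nat (m, r))) y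
  end.

(** [eval O c x y]: program [c] with oracle [O] halts on input [x] with output
    [y]; the oracle answers with the characteristic function of [O]. *)
Fixpoint eval (O : nat_set) (c : prog) (x y : nat) : Prop :=
  match c with
  | PZero => y = 0
  | PSucc => y = S x
  | PFst => y = fst (Cantor.of_nat x)
  | PSnd => y = snd (Cantor.of_nat x)
  | POracle => (O x /\ y = 1) \/ (~ O x /\ y = 0)
  | PPair c d => exists u v, eval O c x u /\ eval O d x v
                             /\ y = Cantor.to_nat (u, v)
  | PComp d c => exists u, eval O c x u /\ eval O d u y
  | PRec c d => prim_rec (eval O c) (eval O d)
                  (fst (Cantor.of_nat x)) (snd (Cantor.of_nat x)) y
  | PMin c => eval O c (Cantor.to_nat (x, y)) 0
              /\ forall m, m < y ->
                   exists v, eval O c (Cantor.to_nat (x, m)) (S v)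
  end.

Fixpoint prog_code (c : prog) : nat :=
  match c with
  | PZero => Cantor.to_nat (0, 0)
  | PSucc => Cantor.to_nat (0, 1)
  | PFst => Cantor.to_nat (0, 2)
  | PSnd => Cantor.to_nat (0, 3)
  | POracle => Cantor.to_nat (0, 4)
  | PPair c d => Cantor.to_nat (1, Cantor.to_nat (prog_code c, prog_code d))
  | PComp d c => Cantor.to_nat (2, Cantor.to_nat (prog_code d, prog_code c))
  | PRec c d => Cantor.to_nat (3, Cantor.to_nat (prog_code c, prog_code d))
  | PMin c => Cantor.to_nat (4, prog_code c)
  end.

Definition empty_set : nat_set := fun _ => False.

Definition recursive_function (f : nat -> nat) : Prop :=
  exists c, forall x, eval empty_set c x (f x).

(** [W e] is the domain of the partial recursive function with index [e]; a
    number that codes no program is an index of the nowhere defined function. *)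
Definition W (e : nat) : nat_set :=
  fun x => exists c y, prog_code c = e /\ eval empty_set c x y.

Definition re_set (A : nat_set) : Prop :=
  exists e, forall x, W e x <-> A x.

Definition turing_le (A B : nat_set) : Prop :=
  exists c, forall x, (A x -> eval B c x 1) /\ (~ A x -> eval B c x 0).

Definition turing_equiv (A B : nat_set) : Prop :=
  turing_le A B /\ turing_le B A.

(** * Turing degrees *)

(** A degree is an equivalence class of [turing_equiv]. *)
Definition deg (A : nat_set) : nat_set -> Prop := fun B => turing_equiv B A.

Definition is_degree (d : nat_set -> Prop) : Prop :=
  exists A, forall B, d B <-> deg A B.

Definition re_degree (d : nat_set -> Prop) : Prop :=
  is_degree d /\ exists A, re_set A /\ d A.

Definition deg_le (d d' : nat_set -> Prop) : Prop :=
  exists A B, d A /\ d' B /\ turing_le A B.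

Definition deg_lt (d d' : nat_set -> Prop) : Prop :=
  deg_le d d' /\ ~ deg_le d' d.

Definition deg_zero : nat_set -> Prop := deg empty_set.

Definition deg_jump_zero : nat_set -> Prop := deg (fun e => W e e).

(** * Propositional theories *)

Inductive form : Type :=
| Var (n : nat)
| Neg (p : form)
| Imp (p q : form).

Fixpoint form_code (p : form) : nat :=
  match p with
  | Var n => Cantor.to_nat (0, n)
  | Neg p => Cantor.to_nat (1, form_code p)
  | Imp p q => Cantor.to_nat (2, Cantor.to_nat (form_code p, form_code q))
  end.

Definition theory := form -> Prop.

(** Lukasiewicz's Hilbert system for classical propositional logic. *)
Inductive proves (T : theory) : form -> Prop :=
| pr_hyp p : T p -> proves T p
| pr_k p q : proves T (Imp p (Imp q p))
| pr_s p q r :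
    proves T (Imp (Imp p (Imp q r)) (Imp (Imp p q) (Imp p r)))
| pr_contra p q : proves T (Imp (Imp (Neg p) (Neg q)) (Imp q p))
| pr_mp p q : proves T (Imp p q) -> proves T p -> proves T q.

(** The set of Goedel numbers of consequences of [T].  Recursive enumerability,
    indices and Turing degree of a theory all refer to this set. *)
Definition thms (T : theory) : nat_set :=
  fun n => exists p, form_code p = n /\ proves T p.

Definition consistent (T : theory) : Prop :=
  ~ exists p, proves T p /\ proves T (Neg p).

Definition complete (T : theory) : Prop :=
  forall p, proves T p \/ proves T (Neg p).

Definition re_theory (T : theory) : Prop := re_set (thms T).

Definition is_index (e : nat) (T : theory) : Prop :=
  forall n, W e n <-> thms T n.

Definition extends (V U : theory) : Prop :=
  forall p, proves U p -> proves V p.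

Definition turing_persistent (U : theory) : Prop :=
  re_theory U /\
  forall V, re_theory V -> consistent V -> extends V U ->
            turing_le (thms U) (thms V).

Definition G1_holds (U : theory) : Prop :=
  forall V, re_theory V -> consistent V -> extends V U -> ~ complete V.

(* Main.v *)
(** Let [A = W a].  The variable with index [n = <e,x>] is decided by the theory
    exactly when [x] enters [A], and its sign depends on a race: it is refuted
    if by then [W e] has already enumerated the formula [Var n], and made an
    axiom otherwise.  If [V] is a consistent extension whose theorems are
    [W e], then [V] computes [A]: if [V] does not prove [Var <e,x>] then [x] is
    not in [A]; if it does, let [t] be a stage at which [W e] has enumerated
    this theorem; an [x] entering [A] after [t] would make [V] refute it too, so
    [x] is in [A] iff it has entered by stage [t].  Conversely, [A] tells which
    variables of a formula get decided, hence a stage after which a truth table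
    decides provability.  A complete consistent r.e. theory is recursive, so
    persistence gives G1 when [A] is not recursive. *)

From Stdlib Require Import Arith Lia Bool Cantor ClassicalEpsilon.
Require Import Defs.

(** * Pairing and bounded quantification *)

Definition pr (x y : nat) : nat := Cantor.to_nat (x, y).
Definition p1 (n : nat) : nat := fst (Cantor.of_nat n).
Definition p2 (n : nat) : nat := snd (Cantor.of_nat n).

Lemma p1_pr x y : p1 (pr x y) = x.
Proof. unfold p1, pr. now rewrite Cantor.cancel_of_to. Qed.

Lemma p2_pr x y : p2 (pr x y) = y.
Proof. unfold p2, pr. now rewrite Cantor.cancel_of_to. Qed.

Lemma pr_eta n : pr (p1 n) (p2 n) = n.
Proof.
  unfold p1, p2, pr. rewrite <- surjective_pairing. apply Cantor.cancel_to_of.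
Qed.

Lemma pr_inj x y x' y' : pr x y = pr x' y' -> x = x' /\ y = y'.
Proof.
  intros H. split.
  - now rewrite <- (p1_pr x y), H, p1_pr.
  - now rewrite <- (p2_pr x y), H, p2_pr.
Qed.

Lemma pr_spec x y : pr x y * 2 = y * 2 + (y + x) * S (y + x).
Proof. apply Cantor.to_nat_spec. Qed.

Lemma pr_mono x y x' y' : x <= x' -> y <= y' -> pr x y <= pr x' y'.
Proof.
  intros Hx Hy. pose proof (pr_spec x y). pose proof (pr_spec x' y').
  assert ((y + x) * S (y + x) <= (y' + x') * S (y' + x'))
    by (apply Nat.mul_le_mono; lia).
  lia.
Qed.

Lemma pr_ge x y : x + y <= pr x y.
Proof. pose proof (Cantor.to_nat_non_decreasing x y). unfold pr. lia. Qed.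

(** A function rather than a [match], so that closure under case distinction is a lemma that
    [simple apply] can use. [prec] and [ball] serve the same purpose for recursion and bounded
    quantification. *)
Definition case {T : Type} (n : nat) (a : T) (b : nat -> T) : T :=
  match n with 0 => a | S m => b m end.

Fixpoint prec (g : nat) (h : nat -> nat -> nat) (n : nat) : nat :=
  match n with 0 => g | S m => h m (prec g h m) end.

Fixpoint ball (p : nat -> bool) (n : nat) : bool :=
  match n with 0 => true | S m => p m && ball p m end.

Lemma ball_true p n : ball p n = true <-> forall i, i < n -> p i = true.
Proof.
  induction n as [|n IH]; simpl.
  - split; [intros _ i Hi; lia | reflexivity].
  - rewrite andb_true_iff, IH. split.
    + intros [H1 H2] i Hi. destruct (Nat.eq_dec i n) as [->|]; [assumption|].
      apply H2. lia.
    + intros H. split; [|intros i Hi]; apply H; lia.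
Qed.

(** * Computable functions *)

Definition computable (O : nat_set) (f : nat -> nat) : Prop :=
  exists c, forall x, eval O c x (f x).

Lemma computable_ext O f g :
  (forall x, f x = g x) -> computable O f -> computable O g.
Proof. intros E [c Hc]. exists c. intros x. rewrite <- E. apply Hc. Qed.

Lemma computable_comp O g f :
  computable O g -> computable O f -> computable O (fun x => g (f x)).
Proof.
  intros [d Hd] [c Hc]. exists (PComp d c). intros x. simpl. eauto.
Qed.

Lemma computable_pr O f g :
  computable O f -> computable O g -> computable O (fun x => pr (f x) (g x)).
Proof.
  intros [c Hc] [d Hd]. exists (PPair c d). intros x. simpl.
  exists (f x), (g x). auto.
Qed.

Lemma computable_p1 O f : computable O f -> computable O (fun x => p1 (f x)).
Proof. apply (computable_comp O p1). exists PFst. intros x. reflexivity. Qed.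

Lemma computable_p2 O f : computable O f -> computable O (fun x => p2 (f x)).
Proof. apply (computable_comp O p2). exists PSnd. intros x. reflexivity. Qed.

Lemma computable_S O f : computable O f -> computable O (fun x => S (f x)).
Proof. apply (computable_comp O S). exists PSucc. intros x. reflexivity. Qed.

Definition id_prog : prog := PPair PFst PSnd.

Lemma eval_id O x : eval O id_prog x x.
Proof.
  simpl. exists (p1 x), (p2 x). repeat split. symmetry. apply pr_eta.
Qed.

Lemma computable_id O : computable O (fun x => x).
Proof. exists id_prog. apply eval_id. Qed.

Fixpoint const_prog (n : nat) : prog :=
  match n with 0 => PZero | S m => PComp PSucc (const_prog m) end.

Lemma eval_const O n x : eval O (const_prog n) x n.
Proof.
  induction n as [|n IH]; simpl; [reflexivity|]. exists n. auto.
Qed.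

Lemma computable_const O n : computable O (fun _ => n).
Proof. exists (const_prog n). apply eval_const. Qed.

(** [PRec] runs on the pair of the input, kept as parameter, and the bound. The step [h] becomes
    unary by reading its arguments off the nested pair that [prim_rec] feeds it. The later closure
    lemmas treat bound arguments in the same way. *)
Lemma computable_prec O g h k :
  computable O g ->
  computable O (fun z => h (p1 z) (p1 (p2 z)) (p2 (p2 z))) ->
  computable O k ->
  computable O (fun x => prec (g x) (h x) (k x)).
Proof.
  intros [c Hc] [d Hd] [e He].
  exists (PComp (PRec c d) (PPair id_prog e)). intros x.
  exists (pr x (k x)). split.
  - exists x, (k x). split; [apply eval_id | split; [apply He | reflexivity]].
  - cbn [eval]. change (prim_rec (eval O c) (eval O d) (p1 (pr x (k x)))
      (p2 (pr x (k x))) (prec (g x) (h x) (k x))).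
    rewrite p1_pr, p2_pr.
    induction (k x) as [|n IH]; simpl; [apply Hc|].
    exists (prec (g x) (h x) n). split; [exact IH|].
    specialize (Hd (pr x (pr n (prec (g x) (h x) n)))). cbn beta in Hd.
    rewrite !p2_pr, !p1_pr in Hd. exact Hd.
Qed.

Lemma computable_case O f a b :
  computable O f -> computable O a ->
  computable O (fun z => b (p1 z) (p2 z)) ->
  computable O (fun x => case (f x) (a x) (fun y => b x y)).
Proof.
  intros Hf Ha Hb.
  apply computable_ext with (fun x => prec (a x) (fun m _ => b x m) (f x)).
  - intros x. now destruct (f x).
  - apply computable_prec; [assumption | | assumption].
    apply computable_ext with (fun z =>
      (fun w => b (p1 w) (p2 w)) (pr (p1 z) (p1 (p2 z)))).
    + intros z. now rewrite p1_pr, p2_pr.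
    + apply (computable_comp O (fun w => b (p1 w) (p2 w))); [assumption|].
      apply computable_pr; repeat apply computable_p1; try apply computable_p2;
        apply computable_id.
Qed.

Notation decidable O p := (computable O (fun x => Nat.b2n (p x))).

Lemma computable_if O b f g :
  decidable O b -> computable O f -> computable O g ->
  computable O (fun x => if b x then f x else g x).
Proof.
  intros Hb Hf Hg.
  apply computable_ext with (fun x => case (Nat.b2n (b x)) (g x) (fun _ => f x)).
  - intros x. now destruct (b x).
  - apply (computable_case O _ _ (fun x _ => f x)); [assumption..|].
    apply computable_comp; [assumption|]. apply computable_p1, computable_id.
Qed.

Lemma decidable_if O b p q :
  decidable O b -> decidable O p -> decidable O q ->
  decidable O (fun x => if b x then p x else q x).
Proof.
  intros Hb Hp Hq.
  apply computable_ext with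
    (fun x => if b x then Nat.b2n (p x) else Nat.b2n (q x)).
  - intros x. now destruct (b x).
  - now apply computable_if.
Qed.

Lemma decidable_andb O p q :
  decidable O p -> decidable O q -> decidable O (fun x => p x && q x).
Proof. intros. apply decidable_if; try assumption. apply computable_const. Qed.

Lemma decidable_orb O p q :
  decidable O p -> decidable O q -> decidable O (fun x => p x || q x).
Proof. intros. apply decidable_if; try assumption. apply computable_const. Qed.

Lemma decidable_negb O p : decidable O p -> decidable O (fun x => negb (p x)).
Proof. intros. apply decidable_if; try assumption; apply computable_const. Qed.

Lemma decidable_implb O p q :
  decidable O p -> decidable O q -> decidable O (fun x => implb (p x) (q x)).
Proof. intros. apply decidable_if; try assumption. apply computable_const. Qed.

Lemma decidable_eqb O p q :
  decidable O p -> decidable O q -> decidable O (fun x => Bool.eqb (p x) (q x)).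
Proof.
  intros Hp Hq.
  apply computable_ext with
    (fun x => Nat.b2n (if p x then q x else negb (q x))).
  - intros x. now destruct (p x), (q x).
  - apply decidable_if; try assumption. now apply decidable_negb.
Qed.

Lemma decidable_case O f p q :
  computable O f -> decidable O p -> decidable O (fun z => q (p1 z) (p2 z)) ->
  decidable O (fun x => case (f x) (p x) (fun y => q x y)).
Proof.
  intros Hf Hp Hq.
  apply computable_ext with
    (fun x => case (f x) (Nat.b2n (p x)) (fun y => Nat.b2n (q x y))).
  - intros x. now destruct (f x).
  - now apply (computable_case O f _ (fun x y => Nat.b2n (q x y))).
Qed.

Lemma decidable_ball O p f :
  decidable O (fun z => p (p1 z) (p2 z)) -> computable O f ->
  decidable O (fun x => ball (fun i => p x i) (f x)).
Proof.
  intros Hp Hf.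
  apply computable_ext with
    (fun x => prec 1 (fun i r => if p x i then r else 0) (f x)).
  - intros x. induction (f x) as [|n IH]; simpl; [reflexivity|].
    rewrite IH. now destruct (p x n).
  - apply (computable_prec O (fun _ => 1) (fun x i r => if p x i then r else 0));
      [apply computable_const | | assumption].
    apply computable_if.
    + apply computable_ext with (fun z =>
        (fun w => Nat.b2n (p (p1 w) (p2 w))) (pr (p1 z) (p1 (p2 z)))).
      * intros z. now rewrite p1_pr, p2_pr.
      * apply (computable_comp O (fun w => Nat.b2n (p (p1 w) (p2 w))));
          [assumption|].
        apply computable_pr; [|apply computable_p1, computable_p2];
          try apply computable_p1; apply computable_id.
    + repeat apply computable_p2. apply computable_id.
    + apply computable_const.
Qed.

Lemma computable_iter O h s k :
  computable O (fun z => h (p1 z) (p2 z)) ->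
  computable O s -> computable O k ->
  computable O (fun x => Nat.iter (k x) (h x) (s x)).
Proof.
  intros Hh Hs Hk.
  apply computable_ext with
    (fun x => prec (s x) (fun _ r => h x r) (k x)).
  - intros x. induction (k x) as [|n IH]; simpl; congruence.
  - apply (computable_prec O s (fun x _ r => h x r)); [assumption| |assumption].
    apply computable_ext with (fun z =>
      (fun w => h (p1 w) (p2 w)) (pr (p1 z) (p2 (p2 z)))).
    + intros z. now rewrite p1_pr, p2_pr.
    + apply (computable_comp O (fun w => h (p1 w) (p2 w))); [assumption|].
      apply computable_pr; repeat apply computable_p1; try apply computable_p1;
        repeat apply computable_p2; apply computable_id.
Qed.

Create HintDb computable.

(** Reads a program off the syntax of the function. Composition is tried only with a function
    already assumed computable, because an arbitrary composition would unify with anything. *)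
Ltac computability :=
  cbv beta;
  first
  [ assumption
  | simple apply computable_id
  | simple apply computable_const
  | match goal with
    | H : computable ?O ?f |- computable ?O (fun z => ?f (@?u z)) =>
        simple apply (computable_comp O f u H); computability
    end
  | solve [auto 1 with computable nocore]
  | first
    [ simple apply computable_pr | simple apply computable_p1
    | simple apply computable_p2 | simple apply computable_S
    | simple apply computable_case | simple apply decidable_case
    | simple apply decidable_andb | simple apply decidable_orb
    | simple apply decidable_negb | simple apply decidable_implb
    | simple apply decidable_eqb | simple apply decidable_ball
    | simple apply decidable_if | simple apply computable_if
    | simple apply computable_iter | simple apply computable_prec ];
    computability ].

(** * Unbounded search and oracle queries *)

Lemma least_witness (p : nat -> bool) :
  (exists y, p y = true) ->
  exists y, p y = true /\ forall m, m < y -> p m = false.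
Proof.
  intros [y Hy]. induction y as [y IH] using lt_wf_ind.
  destruct (classic (exists m, m < y /\ p m = true)) as [[m [Hm Hp]]|Hn].
  - now apply (IH m).
  - exists y. split; [assumption|]. intros m Hm.
    apply not_true_is_false. intros E. apply Hn. eauto.
Qed.

Lemma computable_search O p :
  decidable O (fun z => p (p1 z) (p2 z)) ->
  (forall x, exists y, p x y = true) ->
  exists f, computable O f /\ forall x, p x (f x) = true.
Proof.
  intros Hp Hex.
  assert (Hmin : forall x, exists y,
             p x y = true /\ forall m, m < y -> p x m = false)
    by (intros x; apply least_witness, Hex).
  (* Choice only names the least witnesses as a function; [PMin] is what computes them. *)
  set (f := fun x => proj1_sig (constructive_indefinite_description _ (Hmin x))).
  exists f.
  assert (Hf : forall x, p x (f x) = true /\ forall m, m < f x -> p x m = false)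
    by (intros x; unfold f;
        exact (proj2_sig (constructive_indefinite_description _ (Hmin x)))).
  split; [|apply Hf].
  (* [PMin] searches for the output 0, hence the negated test. *)
  apply decidable_negb in Hp. destruct Hp as [c Hc].
  exists (PMin c). intros x. destruct (Hf x) as [H1 H2]. simpl. split.
  - specialize (Hc (pr x (f x))). cbn beta in Hc.
    rewrite p1_pr, p2_pr, H1 in Hc. exact Hc.
  - intros m Hm. exists 0. specialize (Hc (pr x m)). cbn beta in Hc.
    rewrite p1_pr, p2_pr, (H2 m Hm) in Hc. exact Hc.
Qed.

(** Makes an oracle query a boolean, so that tests using the oracle are built with the same
    connectives and closure lemmas as all others. *)
Definition holds (P : Prop) : bool :=
  if excluded_middle_informative P then true else false.

Lemma holds_true P : holds P = true <-> P.
Proof.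
  unfold holds. destruct (excluded_middle_informative P); intuition congruence.
Qed.

Lemma decidable_oracle O f :
  computable O f -> decidable O (fun x => holds (O (f x))).
Proof.
  apply (computable_comp O (fun x => Nat.b2n (holds (O x)))). exists POracle.
  intros x. simpl. unfold holds.
  destruct (excluded_middle_informative (O x)); simpl; auto.
Qed.

Lemma turing_le_decidable A B p :
  decidable B p -> (forall x, p x = true <-> A x) -> turing_le A B.
Proof.
  intros [c Hc] Hp. exists c. intros x. specialize (Hc x). split; intros H.
  - apply Hp in H. now rewrite H in Hc.
  - destruct (p x) eqn:E; [|exact Hc]. now apply Hp in E.
Qed.

(** * Transitivity of Turing reducibility *)

Fixpoint replace_oracle (s c : prog) : prog :=
  match c with
  | POracle => s
  | PPair c d => PPair (replace_oracle s c) (replace_oracle s d)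
  | PComp d c => PComp (replace_oracle s d) (replace_oracle s c)
  | PRec c d => PRec (replace_oracle s c) (replace_oracle s d)
  | PMin c => PMin (replace_oracle s c)
  | c => c
  end.

Lemma eval_replace_oracle (B C : nat_set) s :
  (forall x, (B x -> eval C s x 1) /\ (~ B x -> eval C s x 0)) ->
  forall c x y, eval B c x y -> eval C (replace_oracle s c) x y.
Proof.
  intros Hs. induction c as [ | | | | |c IHc d IHd|d IHd c IHc|c IHc d IHd|c IHc];
    intros x y H; simpl in *; try exact H.
  - destruct H as [[H ->]|[H ->]]; now apply Hs.
  - destruct H as (u & v & Hu & Hv & ->). exists u, v. auto.
  - destruct H as (u & Hu & Hy). exists u. auto.
  - revert y H. generalize (fst (Cantor.of_nat x)).
    induction (snd (Cantor.of_nat x)) as [|n IHn]; intros a y; simpl; [auto|].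
    intros (r & Hr & Hy). exists r. auto.
  - destruct H as [H1 H2]. split; [auto|]. intros m Hm.
    destruct (H2 m Hm) as [v Hv]. exists v. auto.
Qed.

Lemma turing_le_trans A B C : turing_le A B -> turing_le B C -> turing_le A C.
Proof.
  intros [c Hc] [s Hs]. exists (replace_oracle s c). intros x.
  split; intros H; apply (eval_replace_oracle B C s Hs); now apply Hc.
Qed.

Lemma eval_functional O c : forall x y y', eval O c x y -> eval O c x y' -> y = y'.
Proof.
  induction c as [ | | | | |c IHc d IHd|d IHd c IHc|c IHc d IHd|c IHc];
    intros x y y' H H'; simpl in H, H'; try congruence.
  - intuition congruence.
  - destruct H as (u & v & Hu & Hv & ->), H' as (u' & v' & Hu' & Hv' & ->).
    now rewrite (IHc _ _ _ Hu Hu'), (IHd _ _ _ Hv Hv').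
  - destruct H as (u & Hu & Hy), H' as (u' & Hu' & Hy').
    rewrite (IHc _ _ _ Hu Hu') in Hy. eauto.
  - revert y y' H H'. induction (snd (Cantor.of_nat x)) as [|n IHn];
      simpl; intros y y'; [eauto|].
    intros (r & Hr & Hy) (r' & Hr' & Hy'). rewrite (IHn _ _ Hr Hr') in Hy. eauto.
  - destruct H as [H0 H1], H' as [H0' H1'].
    destruct (lt_eq_lt_dec y y') as [[Hlt|Heq]|Hlt]; [|exact Heq|].
    + destruct (H1' y Hlt) as [v Hv]. pose proof (IHc _ _ _ H0 Hv). discriminate.
    + destruct (H1 y' Hlt) as [v Hv]. pose proof (IHc _ _ _ H0' Hv). discriminate.
Qed.

(** * A step-bounded evaluator *)

(** States of a stack machine evaluating (codes of) oracle-free programs: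
    [ev c x k] is about to run [c] on [x], [ret y k] to pass the value [y] to
    the stack [k].  A stack is empty if its first component is [0]. *)
Definition ev (c x k : nat) : nat := pr 0 (pr c (pr x k)).
Definition ret (y k : nat) : nat := pr 1 (pr y k).
Definition frame (t d k : nat) : nat := pr (S t) (pr d k).

(** Waits for the value of the recursion at [m], with [rest] rounds still to run. *)
Definition rec_frame (d a m rest k : nat) : nat :=
  frame 2 (pr d (pr a (pr m rest))) k.
Definition min_frame (c x m k : nat) : nat := frame 3 (pr c (pr x m)) k.

(** The innermost default 0 is the answer of the empty oracle. *)
Definition step_base (t x : nat) : nat :=
  case t 0 (fun t => case t (S x) (fun t => case t (p1 x) (fun t =>
  case t (p2 x) (fun _ => 0)))).

Definition step_ev (c x k : nat) : nat :=
  case (p1 c) (ret (step_base (p2 c) x) k) (fun t =>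
  case t (ev (p1 (p2 c)) x (frame 0 (pr (p2 (p2 c)) x) k)) (fun t =>
  case t (ev (p2 (p2 c)) x (frame 1 (p1 (p2 c)) k)) (fun t =>
  case t (ev (p1 (p2 c)) (p1 x) (rec_frame (p2 (p2 c)) (p1 x) 0 (p2 x) k))
    (fun _ => ev (p2 c) (pr x 0) (min_frame (p2 c) x 0 k))))).

Definition step_ret_rec (d a m rest y k : nat) : nat :=
  case rest (ret y k)
    (fun r => ev d (pr a (pr m y)) (rec_frame d a (S m) r k)).

Definition step_ret_min (c x m y k : nat) : nat :=
  case y (ret m k) (fun _ => ev c (pr x (S m)) (min_frame c x (S m) k)).

(** Frame 0 holds the pending second half of a pair with its input, 1 the outer program of a
    composition, 2 a recursion, 3 a minimisation, and 4 the finished first half of a pair. *)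
Definition step_ret_frame (t d y k : nat) : nat :=
  case t (ev (p1 d) (p2 d) (frame 4 y k)) (fun t =>
  case t (ev d y k) (fun t =>
  case t (step_ret_rec (p1 d) (p1 (p2 d)) (p1 (p2 (p2 d))) (p2 (p2 (p2 d))) y k)
    (fun t =>
  case t (step_ret_min (p1 d) (p1 (p2 d)) (p2 (p2 d)) y k)
    (fun _ => ret (pr d y) k)))).

(** With an empty stack the machine idles, which makes halting monotone in the number of steps. *)
Definition step_ret (y k : nat) : nat :=
  case (p1 k) (ret y k) (fun t => step_ret_frame t (p1 (p2 k)) y (p2 (p2 k))).

Definition step (s : nat) : nat :=
  case (p1 s) (step_ev (p1 (p2 s)) (p1 (p2 (p2 s))) (p2 (p2 (p2 s))))
    (fun _ => step_ret (p1 (p2 s)) (p2 (p2 s))).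

Definition halted (s : nat) : bool :=
  case (p1 s) false
    (fun _ => case (p1 (p2 (p2 s))) true (fun _ => false)).

Definition run (s n : nat) : nat := Nat.iter n step s.

Definition halts_in (e x n : nat) : bool := halted (run (ev e x 0) n).

Lemma decidable_halts_in O e x n :
  computable O e -> computable O x -> computable O n ->
  decidable O (fun z => halts_in (e z) (x z) (n z)).
Proof.
  intros He Hx Hn.
  unfold halts_in, run, halted, step, step_ret, step_ret_frame, step_ret_min,
    step_ret_rec, step_ev, step_base, min_frame, rec_frame, frame, ret, ev.
  computability.
Qed.
#[local] Hint Extern 1 => simple apply decidable_halts_in; computability : computable.
#[local] Hint Extern 1 => simple apply decidable_oracle; computability : computable.

Ltac pairs := repeat (rewrite p1_pr || rewrite p2_pr); cbn [case].

Ltac fold_pr :=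
  repeat match goal with
  | |- context [Cantor.to_nat (?x, ?y)] =>
      change (Cantor.to_nat (x, y)) with (pr x y)
  | H : context [Cantor.to_nat (?x, ?y)] |- _ =>
      change (Cantor.to_nat (x, y)) with (pr x y) in H
  end.

Lemma step_ev_eq c x k : step (ev c x k) = step_ev c x k.
Proof. unfold step, ev. now pairs. Qed.

Lemma step_ret_eq t d y k : step (ret y (frame t d k)) = step_ret_frame t d y k.
Proof. unfold step, step_ret, ret, frame. now pairs. Qed.

Lemma step_atom t x k : step (ev (pr 0 t) x k) = ret (step_base t x) k.
Proof. rewrite step_ev_eq. unfold step_ev. now pairs. Qed.

Lemma step_pair c d x k :
  step (ev (prog_code (PPair c d)) x k)
  = ev (prog_code c) x (frame 0 (pr (prog_code d) x) k).
Proof.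
  rewrite step_ev_eq. cbn [prog_code].
  fold_pr. unfold step_ev. now pairs.
Qed.

Lemma step_comp c d x k :
  step (ev (prog_code (PComp d c)) x k)
  = ev (prog_code c) x (frame 1 (prog_code d) k).
Proof.
  rewrite step_ev_eq. cbn [prog_code].
  fold_pr. unfold step_ev. now pairs.
Qed.

Lemma step_rec c d x k :
  step (ev (prog_code (PRec c d)) x k)
  = ev (prog_code c) (p1 x) (rec_frame (prog_code d) (p1 x) 0 (p2 x) k).
Proof.
  rewrite step_ev_eq. cbn [prog_code].
  fold_pr. unfold step_ev. now pairs.
Qed.

Lemma step_min c x k :
  step (ev (prog_code (PMin c)) x k)
  = ev (prog_code c) (pr x 0) (min_frame (prog_code c) x 0 k).
Proof.
  rewrite step_ev_eq. cbn [prog_code].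
  fold_pr. unfold step_ev. now pairs.
Qed.

Lemma step_ret_0 d x u k :
  step (ret u (frame 0 (pr d x) k)) = ev d x (frame 4 u k).
Proof. rewrite step_ret_eq. unfold step_ret_frame. now pairs. Qed.

Lemma step_ret_1 d u k : step (ret u (frame 1 d k)) = ev d u k.
Proof. rewrite step_ret_eq. reflexivity. Qed.

Lemma step_rec_frame d a m rest y k :
  step (ret y (rec_frame d a m rest k)) = step_ret_rec d a m rest y k.
Proof. unfold rec_frame. rewrite step_ret_eq. unfold step_ret_frame. now pairs. Qed.

Lemma step_min_frame c x m y k :
  step (ret y (min_frame c x m k)) = step_ret_min c x m y k.
Proof. unfold min_frame. rewrite step_ret_eq. unfold step_ret_frame. now pairs. Qed.

Lemma step_ret_4 u v k : step (ret v (frame 4 u k)) = ret (pr u v) k.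
Proof. rewrite step_ret_eq. reflexivity. Qed.

Lemma run_S s n : run s (S n) = run (step s) n.
Proof. apply Nat.iter_succ_r. Qed.

Lemma halted_ev c x k : halted (ev c x k) = false.
Proof. unfold halted, ev. now pairs. Qed.

Lemma halted_frame y t d k : halted (ret y (frame t d k)) = false.
Proof. unfold halted, ret, frame. now pairs. Qed.

Lemma halted_ret y : halted (ret y 0) = true.
Proof. unfold halted, ret. now pairs. Qed.

Lemma halted_step s : halted s = true -> halted (step s) = true.
Proof.
  unfold halted at 1, step.
  destruct (p1 s) as [|n]; [discriminate|]. cbn [case].
  unfold step_ret. destruct (p1 (p2 (p2 s))) eqn:E; [|discriminate].
  cbn [case]. intros _. unfold halted, ret. pairs. now rewrite E.
Qed.

Lemma halts_in_mono e x n m :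
  n <= m -> halts_in e x n = true -> halts_in e x m = true.
Proof.
  intros Hle H. induction Hle as [|m _ IH]; [exact H|]. now apply halted_step.
Qed.

Definition reaches (s s' : nat) : Prop := exists n, run s n = s'.

Lemma reaches_refl s : reaches s s.
Proof. now exists 0. Qed.

Lemma reaches_step s s' : reaches (step s) s' -> reaches s s'.
Proof. intros [n Hn]. exists (S n). now rewrite run_S. Qed.

Lemma reaches_trans s s' s'' : reaches s s' -> reaches s' s'' -> reaches s s''.
Proof.
  intros [n <-] [m <-]. exists (m + n). unfold run. apply Nat.iter_add.
Qed.

Lemma eval_reaches c : forall x y k,
  eval empty_set c x y -> reaches (ev (prog_code c) x k) (ret y k).
Proof.
  induction c as [ | | | | |c IHc d IHd|d IHd c IHc|c IHc d IHd|c IHc];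
    intros x y k H; apply reaches_step.
  1-5: simpl in H; cbn [prog_code].
  1-4: subst y.
  5: destruct H as [[[] _]|[_ ->]].
  1-5: fold_pr; rewrite step_atom; apply reaches_refl.
  - destruct H as (u & v & Hu & Hv & ->). rewrite step_pair.
    eapply reaches_trans; [apply IHc, Hu|].
    apply reaches_step. rewrite step_ret_0.
    eapply reaches_trans; [apply IHd, Hv|].
    apply reaches_step. rewrite step_ret_4. apply reaches_refl.
  - destruct H as (u & Hu & Hy). rewrite step_comp.
    eapply reaches_trans; [apply IHc, Hu|].
    apply reaches_step. rewrite step_ret_1. now apply IHd.
  - rewrite step_rec. simpl in H. fold (p1 x) (p2 x) in H.
    (* Invariant of the loop: once the value at [m] is returned, [m + rest] is still the total
       number of rounds. *)
    assert (Hm : forall n m rest, p2 x = m + rest -> n = m -> forall r,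
      prim_rec (eval empty_set c) (eval empty_set d) (p1 x) m r ->
      reaches (ev (prog_code c) (p1 x)
                 (rec_frame (prog_code d) (p1 x) 0 (p2 x) k))
              (ret r (rec_frame (prog_code d) (p1 x) m rest k))).
    { intros n m. revert n. induction m as [|m IHm]; intros n rest E _ r Hr.
      - simpl in E. subst rest. now apply IHc.
      - destruct Hr as (r' & Hr' & Hr).
        eapply reaches_trans; [eapply (IHm m (S rest)); [lia|reflexivity|exact Hr']|].
        apply reaches_step. rewrite step_rec_frame. cbn [step_ret_rec case].
        now apply IHd. }
    eapply reaches_trans; [apply (Hm _ (p2 x) 0 ltac:(lia) eq_refl y H)|].
    apply reaches_step. rewrite step_rec_frame. apply reaches_refl.
  - rewrite step_min. destruct H as [H0 H1].
    (* Here [j] is the distance from the candidate [m] to the least zero [y]. *)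
    assert (Hm : forall j m, y = m + j ->
      reaches (ev (prog_code c) (pr x m) (min_frame (prog_code c) x m k))
              (ret y k)).
    { induction j as [|j IHj]; intros m E.
      - rewrite Nat.add_0_r in E. subst m.
        eapply reaches_trans; [apply IHc, H0|].
        apply reaches_step. rewrite step_min_frame. apply reaches_refl.
      - destruct (H1 m ltac:(lia)) as [v Hv].
        eapply reaches_trans; [apply IHc, Hv|].
        apply reaches_step. rewrite step_min_frame. apply IHj. lia. }
    apply (Hm y 0). lia.
Qed.

Lemma halted_run_ev c x k n :
  halted (run (ev c x k) n) = true ->
  exists m, n = S m /\ halted (run (step (ev c x k)) m) = true.
Proof.
  destruct n as [|m]; [|rewrite run_S; eauto].
  intros H. change (halted (ev c x k) = true) in H.
  rewrite halted_ev in H. discriminate.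
Qed.

Lemma halted_run_frame y t d k n :
  halted (run (ret y (frame t d k)) n) = true ->
  exists m, n = S m /\ halted (run (step (ret y (frame t d k))) m) = true.
Proof.
  destruct n as [|m]; [|rewrite run_S; eauto].
  intros H. change (halted (ret y (frame t d k)) = true) in H.
  rewrite halted_frame in H. discriminate.
Qed.

(** Conversely, a halting run from [ev] passes through [ret]; the bound on the
    number of remaining steps makes the induction on minimisation work. *)
Lemma halted_eval c : forall x k n,
  halted (run (ev (prog_code c) x k) n) = true ->
  exists y m, m < n /\ eval empty_set c x y /\ halted (run (ret y k) m) = true.
Proof.
  induction c as [ | | | | |c IHc d IHd|d IHd c IHc|c IHc d IHd|c IHc];
    intros x k n H; apply halted_run_ev in H; destruct H as (m & -> & H).
  1-5: cbn [prog_code] in H; fold_pr; rewrite step_atom in H; eexists _, m;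
    split; [lia|]; split; [|exact H]; simpl; auto.
  - rewrite step_pair in H.
    apply IHc in H. destruct H as (u & n1 & L1 & Hu & H).
    apply halted_run_frame in H. destruct H as (n2 & -> & H).
    rewrite step_ret_0 in H.
    apply IHd in H. destruct H as (v & n3 & L3 & Hv & H).
    apply halted_run_frame in H. destruct H as (n4 & -> & H).
    rewrite step_ret_4 in H.
    exists (pr u v), n4. split; [lia|]. split; [|exact H]. simpl. eauto.
  - rewrite step_comp in H.
    apply IHc in H. destruct H as (u & n1 & L1 & Hu & H).
    apply halted_run_frame in H. destruct H as (n2 & -> & H).
    rewrite step_ret_1 in H.
    apply IHd in H. destruct H as (v & n3 & L3 & Hv & H).
    exists v, n3. split; [lia|]. split; [|exact H]. simpl. eauto.
  - rewrite step_rec in H.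
    apply IHc in H. destruct H as (u & n1 & L1 & Hu & H).
    assert (Hrec : forall rest i r n,
      prim_rec (eval empty_set c) (eval empty_set d) (p1 x) i r ->
      halted (run (ret r (rec_frame (prog_code d) (p1 x) i rest k)) n) = true ->
      exists y n', n' < n /\
        prim_rec (eval empty_set c) (eval empty_set d) (p1 x) (i + rest) y /\
        halted (run (ret y k) n') = true).
    { induction rest as [|rest IHr]; intros i r n Hr Hn;
        apply halted_run_frame in Hn; destruct Hn as (n' & -> & Hn);
        fold (rec_frame (prog_code d) (p1 x) i (S rest) k) in Hn ||
        fold (rec_frame (prog_code d) (p1 x) i 0 k) in Hn;
        rewrite step_rec_frame in Hn; cbn [step_ret_rec case] in Hn.
      - exists r, n'. rewrite Nat.add_0_r. auto.
      - apply IHd in Hn. destruct Hn as (v & n2 & L2 & Hv & Hn).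
        apply (IHr (S i) v) in Hn; [|exists r; auto].
        destruct Hn as (y & n3 & L3 & Hy & Hn). exists y, n3.
        split; [lia|]. split; [|exact Hn].
        now replace (i + S rest) with (S i + rest) by lia. }
    destruct (Hrec (p2 x) 0 u n1 Hu H) as (y & n' & L & Hy & Hn).
    exists y, n'. split; [lia|]. auto.
  - rewrite step_min in H.
    assert (Hmin : forall n i,
      (forall j, j < i -> exists v, eval empty_set c (pr x j) (S v)) ->
      halted (run (ev (prog_code c) (pr x i) (min_frame (prog_code c) x i k)) n)
        = true ->
      exists y n', n' < n /\ eval empty_set (PMin c) x y /\
        halted (run (ret y k) n') = true).
    { induction n as [n IHn] using lt_wf_ind. intros i Hi Hn.
      apply IHc in Hn. destruct Hn as (v & n1 & L1 & Hv & Hn).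
      apply halted_run_frame in Hn. destruct Hn as (n2 & -> & Hn).
      fold (min_frame (prog_code c) x i k) in Hn.
      rewrite step_min_frame in Hn. unfold step_ret_min in Hn.
      destruct v as [|v]; cbn [case] in Hn.
      - exists i, n2. split; [lia|]. split; [|exact Hn]. split; assumption.
      - destruct (IHn n2 ltac:(lia) (S i)) as (y & n3 & L3 & Hy & Hn3).
        + intros j Hj. destruct (Nat.eq_dec j i) as [->|]; [eauto|].
          apply Hi. lia.
        + exact Hn.
        + exists y, n3. split; [lia|]. auto. }
    destruct (Hmin m 0) as (y & n' & L & Hy & Hn);
      [intros j Hj; lia | exact H |].
    exists y, n'. split; [lia|]. auto.
Qed.

(** * The sets [W e] as halting sets of the machine *)

Lemma prog_code_inj c : forall d, prog_code c = prog_code d -> c = d.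
Proof.
  induction c as [ | | | | |c1 IH1 c2 IH2|c1 IH1 c2 IH2|c1 IH1 c2 IH2|c IH];
    intros [ | | | | |d1 d2|d1 d2|d1 d2|d] E; cbn [prog_code] in E;
    fold_pr; apply pr_inj in E; destruct E as [E1 E]; try discriminate; try reflexivity.
  1-3: apply pr_inj in E; destruct E as [E E']; f_equal; auto.
  f_equal. auto.
Qed.

Lemma W_prog_code c x :
  W (prog_code c) x <-> exists y, eval empty_set c x y.
Proof.
  split.
  - intros (d & y & E & H). apply prog_code_inj in E. subst d. eauto.
  - intros [y H]. exists c, y. auto.
Qed.

Lemma halts_in_prog_code c x :
  (exists n, halts_in (prog_code c) x n = true) <-> W (prog_code c) x.
Proof.
  rewrite W_prog_code. split.
  - intros [n Hn]. apply halted_eval in Hn. destruct Hn as (y & _ & _ & H & _).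
    eauto.
  - intros [y Hy]. apply (eval_reaches c x y 0) in Hy. destruct Hy as [n Hn].
    exists n. unfold halts_in. rewrite Hn. apply halted_ret.
Qed.

(** Nonemptiness excludes numbers coding no program, on which the machine may
    halt although [W e] is empty. *)
Lemma halts_in_W e : (exists x, W e x) -> forall x,
  (exists n, halts_in e x n = true) <-> W e x.
Proof. intros [x0 (c & _ & <- & _)] x. apply halts_in_prog_code. Qed.

(** * Bounded truth tables *)

(** A table is an endless stream of entries in nested pairs, so its length need not be stored. *)
Definition bit (i w : nat) : bool :=
  case (p1 (Nat.iter i p2 w)) false (fun _ => true).

(** Chosen so that, by monotonicity of [pr], every pattern of [n] bits has a table below it.
    Quantifying over valuations thus becomes bounded. *)
Definition table_bound (n : nat) : nat := prec 1 (fun _ r => S (pr 1 r)) n.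

Lemma table_exists n : forall h : nat -> bool,
  exists w, w < table_bound n /\ forall i, i < n -> bit i w = h i.
Proof.
  induction n as [|n IH]; intros h.
  - exists 0. split; [unfold table_bound; simpl; lia | intros i Hi; lia].
  - destruct (IH (fun i => h (S i))) as (w & Hw & Hbit).
    exists (pr (Nat.b2n (h 0)) w). split.
    + change (table_bound (S n)) with (S (pr 1 (table_bound n))).
      apply Nat.lt_succ_r, pr_mono; [destruct (h 0); simpl|]; lia.
    + intros [|i] Hi.
      * unfold bit. simpl. rewrite p1_pr. now destruct (h 0).
      * rewrite <- Hbit by lia. unfold bit.
        now rewrite Nat.iter_succ_r, p2_pr.
Qed.

(** [c w i] is a local condition at [i] on the table [w]. *)
Definition forced (c : nat -> nat -> bool) (m : nat) : bool :=
  ball (fun w => implb (ball (fun i => c w i) (S m)) (bit m w))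
    (table_bound (S m)).

Lemma forced_true c m : forced c m = true <->
  forall w, w < table_bound (S m) -> (forall i, i <= m -> c w i = true) ->
  bit m w = true.
Proof.
  unfold forced. rewrite ball_true.
  split; intros H w Hw; specialize (H w Hw).
  - intros Hc. rewrite implb_true_iff, ball_true in H. apply H.
    intros i Hi. apply Hc. lia.
  - rewrite implb_true_iff, ball_true. intros Hc. apply H.
    intros i Hi. apply Hc. lia.
Qed.

(** * Truth-table tests for being a formula and for being entailed *)

(** The formula codes are the least set closed under the formation rules, so a number codes a
    formula iff every closed table marks it. This replaces course-of-values recursion on codes by a
    bounded quantifier. *)
Definition closed_at (w i : nat) : bool :=
  case (p1 i) (bit i w) (fun t =>
  case t (implb (bit (p2 i) w) (bit i w)) (fun t =>
  case t (implb (bit (p1 (p2 i)) w && bit (p2 (p2 i)) w) (bit i w))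
    (fun _ => true))).

Definition is_form (m : nat) : bool := forced closed_at m.

(** The first stage at which [x] enters [W a], for [n = <e,x>], is compared
    with the first stage at which the code of [Var n] enters [W e]. *)
Definition no_later_in (a n s : nat) : bool :=
  ball (fun t => implb (halts_in (p1 n) (pr 0 n) t) (halts_in a (p2 n) t)) s.

(** A variable is constrained only if it is decided by stage [s]. The guard [is_form] is there
    because a table of true formulas marks no other number, and would break the clause for negation
    at a number such as [pr 1 j] with [j] not a formula code. *)
Definition valuation_at (a s w i : nat) : bool :=
  implb (is_form i)
    (case (p1 i)
      (implb (halts_in a (p2 (p2 i)) s)
        (Bool.eqb (bit i w) (no_later_in a (p2 i) s))) (fun t =>
    case t (Bool.eqb (bit i w) (negb (bit (p2 i) w))) (fun t =>
    case t (Bool.eqb (bit i w) (implb (bit (p1 (p2 i)) w) (bit (p2 (p2 i)) w)))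
      (fun _ => true)))).

Definition entails_in (a m s : nat) : bool :=
  is_form m && forced (valuation_at a s) m.

Lemma decidable_is_form O m :
  computable O m -> decidable O (fun z => is_form (m z)).
Proof.
  intros Hm. unfold is_form, forced, closed_at, table_bound, bit.
  computability.
Qed.
#[local] Hint Extern 1 => simple apply decidable_is_form; computability : computable.

Lemma decidable_entails_in O a m s :
  computable O a -> computable O m -> computable O s ->
  decidable O (fun z => entails_in (a z) (m z) (s z)).
Proof.
  intros Ha Hm Hs.
  unfold entails_in, forced, valuation_at, no_later_in, table_bound, bit.
  computability.
Qed.
#[local] Hint Extern 1 => simple apply decidable_entails_in; computability : computable.

(** * Formulas and their codes *)

Lemma form_code_inj p : forall q, form_code p = form_code q -> p = q.
Proof.
  induction p as [n|p IH|p1 IH1 p2 IH2]; intros [m|q|q1 q2] E;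
    cbn [form_code] in E; fold_pr; apply pr_inj in E; destruct E as [E1 E];
    try discriminate; try congruence.
  - f_equal. auto.
  - apply pr_inj in E. destruct E as [E E']. f_equal; auto.
Qed.

Lemma form_code_Var n : form_code (Var n) = pr 0 n.
Proof. reflexivity. Qed.

Lemma form_code_Neg p : form_code (Neg p) = pr 1 (form_code p).
Proof. reflexivity. Qed.

Lemma form_code_Imp p q :
  form_code (Imp p q) = pr 2 (pr (form_code p) (form_code q)).
Proof. reflexivity. Qed.

Lemma form_code_Neg_le p m : form_code (Neg p) <= m -> form_code p <= m.
Proof. rewrite form_code_Neg. pose proof (pr_ge 1 (form_code p)). lia. Qed.

Lemma form_code_Imp_le p q m :
  form_code (Imp p q) <= m -> form_code p <= m /\ form_code q <= m.
Proof.
  rewrite form_code_Imp. pose proof (pr_ge 2 (pr (form_code p) (form_code q))).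
  pose proof (pr_ge (form_code p) (form_code q)). lia.
Qed.

(** Forwards, the table of the actual formula codes is closed, so it marks [m]. Backwards, a closed
    table marks all subformulas by induction. *)
Lemma is_form_true m : is_form m = true <-> exists p, form_code p = m.
Proof.
  unfold is_form. rewrite forced_true. split.
  - intros H.
    destruct (table_exists (S m) (fun i => holds (exists p, form_code p = i)))
      as (w & Hw & Hbit).
    apply holds_true. rewrite <- Hbit by lia. apply H; [exact Hw|].
    intros i Hi. unfold closed_at.
    (* Components never exceed their pair, so the bits consulted at [i] all lie inside the table. *)
    pose proof (pr_ge (p1 (p2 i)) (p2 (p2 i))) as L2. rewrite pr_eta in L2.
    pose proof (pr_ge (p1 i) (p2 i)) as L1. rewrite pr_eta in L1.
    rewrite !Hbit by lia.
    destruct (p1 i) as [|[|[|t]]] eqn:E; cbn [case]; [| | |reflexivity];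
      rewrite ?implb_true_iff, ?andb_true_iff, !holds_true.
    + exists (Var (p2 i)). now rewrite form_code_Var, <- E, pr_eta.
    + intros [p Hp]. exists (Neg p). now rewrite form_code_Neg, Hp, <- E, pr_eta.
    + intros [[p Hp] [q Hq]]. exists (Imp p q).
      now rewrite form_code_Imp, Hp, Hq, pr_eta, <- E, pr_eta.
  - intros [p <-] w _ Hw.
    assert (H : forall q, form_code q <= form_code p ->
                          bit (form_code q) w = true).
    { induction q as [n|q IH|q IHq r IHr]; intros L; pose proof (Hw _ L) as C;
        unfold closed_at in C.
      - now rewrite form_code_Var, p1_pr in C.
      - rewrite form_code_Neg, p1_pr, p2_pr, <- form_code_Neg in C.
        cbn [case] in C. rewrite implb_true_iff in C.
        now apply C, IH, form_code_Neg_le.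
      - rewrite form_code_Imp, p1_pr, !p2_pr, p1_pr, <- form_code_Imp in C.
        cbn [case] in C. rewrite implb_true_iff, andb_true_iff in C.
        apply form_code_Imp_le in L. apply C. split; tauto. }
    now apply H.
Qed.

Fixpoint sat (v : nat -> bool) (p : form) : bool :=
  match p with
  | Var n => v n
  | Neg p => negb (sat v p)
  | Imp p q => implb (sat v p) (sat v q)
  end.

Lemma sat_ext v v' p :
  (forall n, pr 0 n <= form_code p -> v n = v' n) -> sat v p = sat v' p.
Proof.
  (* The bound is decoupled from the formula, so that it stays fixed in the induction on
     subformulas. *)
  assert (H : forall m, (forall n, pr 0 n <= m -> v n = v' n) ->
                        form_code p <= m -> sat v p = sat v' p).
  { intros m Hv. induction p as [n|p IH|p IHp q IHq]; intros L; simpl.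
    - now apply Hv.
    - now rewrite IH by now apply form_code_Neg_le.
    - apply form_code_Imp_le in L. rewrite IHp, IHq by tauto. reflexivity. }
  intros Hv. now apply (H (form_code p)).
Qed.

(** Valuations and tables translate into each other: a valuation yields the table of the formulas it
    satisfies, and an admissible table evaluates formulas as its own entries at the variables do. *)
Lemma forced_valuation_true a s p :
  forced (valuation_at a s) (form_code p) = true <->
  forall v,
    (forall n, pr 0 n <= form_code p -> halts_in a (p2 n) s = true ->
               v n = no_later_in a n s) ->
    sat v p = true.
Proof.
  rewrite forced_true. split.
  - intros H v Hv.
    destruct (table_exists (S (form_code p))
      (fun i => holds (exists q, form_code q = i /\ sat v q = true)))
      as (w & Hw & Hbit).
    assert (Hsat : forall q, form_code q <= form_code p ->
                             bit (form_code q) w = sat v q).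
    { intros q L. rewrite Hbit by lia. apply eq_true_iff_eq.
      rewrite holds_true. split; [|eauto].
      intros (q' & E & Hq'). now apply form_code_inj in E as ->. }
    rewrite <- Hsat by lia. apply H; [exact Hw|]. intros i Hi.
    unfold valuation_at. rewrite implb_true_iff, is_form_true.
    intros [q <-]. destruct q as [n|q|q r].
    + rewrite Hsat by exact Hi. rewrite form_code_Var, p1_pr, p2_pr.
      cbn [case sat]. rewrite implb_true_iff, eqb_true_iff. now apply Hv.
    + rewrite Hsat by exact Hi. rewrite form_code_Neg, p1_pr, p2_pr.
      cbn [case sat].
      rewrite Hsat by now apply form_code_Neg_le. apply eqb_reflx.
    + rewrite Hsat by exact Hi. rewrite form_code_Imp, p1_pr, !p2_pr, p1_pr.
      cbn [case sat]. apply form_code_Imp_le in Hi.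
      rewrite !Hsat by tauto. apply eqb_reflx.
  - intros H w _ Hw.
    assert (Hsat : forall q, form_code q <= form_code p ->
              bit (form_code q) w = sat (fun n => bit (pr 0 n) w) q).
    { induction q as [n|q IH|q IHq r IHr]; intros L; [reflexivity|..];
        pose proof (Hw _ L) as C; unfold valuation_at in C;
        rewrite implb_true_iff, is_form_true in C;
        specialize (C (ex_intro _ _ eq_refl)).
      - rewrite form_code_Neg, p1_pr, p2_pr, <- form_code_Neg in C.
        cbn [case] in C. apply eqb_prop in C.
        rewrite C, IH by now apply form_code_Neg_le. reflexivity.
      - rewrite form_code_Imp, p1_pr, !p2_pr, p1_pr, <- form_code_Imp in C.
        cbn [case] in C. apply eqb_prop in C. apply form_code_Imp_le in L.
        rewrite C, IHq, IHr by tauto. reflexivity. }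
    rewrite Hsat by lia. apply H. intros n L Hn.
    pose proof (Hw _ L) as C. unfold valuation_at in C.
    rewrite implb_true_iff, is_form_true in C.
    specialize (C (ex_intro _ (Var n) eq_refl)).
    rewrite p1_pr, p2_pr in C. cbn [case] in C.
    rewrite implb_true_iff, eqb_true_iff in C. auto.
Qed.

(** * The theory *)

Definition no_later (a n : nat) : Prop :=
  forall t, halts_in (p1 n) (pr 0 n) t = true -> halts_in a (p2 n) t = true.

(** These are the models of the axioms; a variable whose second component never enters remains
    free. *)
Definition respects (a : nat) (v : nat -> bool) : Prop :=
  forall n s, halts_in a (p2 n) s = true -> (v n = true <-> no_later a n).

(** Presented semantically: the theory axiomatised by the variables [<e,x>]
    with [x] in [W a] and [no_later a <e,x>], and the negations of the other
    [<e,x>] with [x] in [W a]. *)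
Definition race_theory (a : nat) : theory :=
  fun p => forall v, respects a v -> sat v p = true.

(** The race is over once the second component has entered: from stage [s] on the conclusion of the
    implication holds by monotonicity, so only earlier stages matter. *)
Lemma no_later_in_true a n s :
  halts_in a (p2 n) s = true -> (no_later_in a n s = true <-> no_later a n).
Proof.
  intros Hs. unfold no_later_in, no_later. rewrite ball_true. split.
  - intros H t Ht. destruct (Nat.lt_ge_cases t s) as [L|L].
    + specialize (H t L). rewrite implb_true_iff in H. auto.
    + now apply halts_in_mono with s.
  - intros H t _. rewrite implb_true_iff. apply H.
Qed.

Lemma respects_exists a : exists v, respects a v.
Proof.
  exists (fun n => holds (no_later a n)). intros n s _. apply holds_true.
Qed.

(** The theory already contains all semantic consequences of its axioms, so soundness of the Hilbert
    system makes it deductively closed. *)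
Lemma race_theory_closed a p : proves (race_theory a) p -> race_theory a p.
Proof.
  induction 1 as [p Hp|p q|p q r|p q|p q _ IH1 _ IH2]; intros v Hv; simpl.
  - now apply Hp.
  - now destruct (sat v p), (sat v q).
  - now destruct (sat v p), (sat v q), (sat v r).
  - now destruct (sat v p), (sat v q).
  - specialize (IH1 v Hv). specialize (IH2 v Hv). simpl in IH1.
    now rewrite IH2 in IH1.
Qed.

Lemma thms_form_code T p : thms T (form_code p) <-> proves T p.
Proof.
  split; [|intros H; exists p; auto].
  intros (q & E & H). now apply form_code_inj in E as ->.
Qed.

(** * Approximating the theorems by stages *)

(** A model of all axioms is in particular a model of those found by stage [s]. *)
Lemma entails_in_sound a m s :
  entails_in a m s = true -> thms (race_theory a) m.
Proof.
  unfold entails_in. rewrite andb_true_iff, is_form_true.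
  intros [[p <-] H]. apply thms_form_code, pr_hyp. intros v Hv.
  rewrite forced_valuation_true in H. apply H. intros n _ Hn.
  apply eq_true_iff_eq. rewrite (no_later_in_true _ _ _ Hn).
  exact (Hv n s Hn).
Qed.

(** From such a stage on, no further variable that can occur in the formula coded by [m] gets
    decided, since [n <= pr 0 n]. *)
Definition settled (a m s : nat) : Prop :=
  forall n, n <= m -> (exists t, halts_in a (p2 n) t = true) ->
            halts_in a (p2 n) s = true.

Lemma settled_exists a m : exists s, settled a m s.
Proof.
  assert (H : exists s, forall n, n < S m ->
    (exists t, halts_in a (p2 n) t = true) -> halts_in a (p2 n) s = true).
  { induction (S m) as [|k [s IH]]; [exists 0; intros n Hn; lia|].
    destruct (classic (exists t, halts_in a (p2 k) t = true)) as [[t Ht]|Hk].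
    - exists (max s t). intros n Hn Hex.
      destruct (Nat.eq_dec n k) as [->|].
      + apply halts_in_mono with t; [lia|exact Ht].
      + apply halts_in_mono with s; [lia|]. apply IH; [lia|exact Hex].
    - exists s. intros n Hn Hex. apply IH; [|exact Hex].
      destruct (Nat.eq_dec n k) as [->|]; [contradiction|lia]. }
  destruct H as [s Hs]. exists s. intros n Hn. apply Hs. lia.
Qed.

Lemma entails_in_complete a m s :
  settled a m s -> thms (race_theory a) m -> entails_in a m s = true.
Proof.
  intros Hset (p & <- & Hp). apply race_theory_closed in Hp.
  unfold entails_in. rewrite andb_true_iff, is_form_true.
  split; [eauto|]. rewrite forced_valuation_true. intros v Hv.
  destruct (respects_exists a) as [v0 Hv0].
  (* [v] is constrained only on variables that can occur in [p]; patching it with a model elsewhere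
     gives a model of all axioms that agrees with [v] on [p]. *)
  set (v' := fun n => if pr 0 n <=? form_code p then v n else v0 n).
  rewrite (sat_ext v v').
  - apply Hp. intros n t Ht. unfold v'.
    destruct (Nat.leb_spec (pr 0 n) (form_code p)) as [L|L].
    + assert (Hs : halts_in a (p2 n) s = true).
      { apply Hset; [|eauto]. pose proof (pr_ge 0 n). lia. }
      rewrite (Hv n L Hs). now apply no_later_in_true.
    + now apply (Hv0 n t).
  - intros n L. unfold v'. now apply Nat.leb_le in L as ->.
Qed.

Lemma thms_race_theory a m :
  thms (race_theory a) m <-> exists s, entails_in a m s = true.
Proof.
  split.
  - intros H. destruct (settled_exists a m) as [s Hs]. exists s.
    now apply entails_in_complete.
  - intros [s Hs]. now apply entails_in_sound with s.
Qed.

(** * An index of the theory, uniformly in [a] *)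

(** Theorems are enumerated by searching for a stage that entails them; fixing [a] through a
    constant program is the s-m-n construction. *)
Lemma race_theory_index : exists f, recursive_function f /\
  forall a, is_index (f a) (race_theory a).
Proof.
  assert (HP : decidable empty_set
    (fun z => negb (entails_in (p1 (p1 z)) (p2 (p1 z)) (p2 z))))
    by computability.
  destruct HP as [c Hc].
  exists (fun a => prog_code (PComp (PMin c) (PPair (const_prog a) id_prog))).
  split.
  (* The code written out, with tag 2 for composition and 1 for pairing. Only the code of
     [const_prog a] varies with [a], by primitive recursion. *)
  - apply (computable_ext empty_set (fun a =>
      pr 2 (pr (prog_code (PMin c)) (pr 1 (pr
        (prec (prog_code PZero) (fun _ r => pr 2 (pr (prog_code PSucc) r)) a)
        (prog_code id_prog)))))).
    + intros a.
      replace (prec (prog_code PZero) _ a) with (prog_code (const_prog a));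
        [reflexivity|].
      induction a as [|a IH]; [reflexivity|].
      cbn [const_prog prec]. now rewrite <- IH.
    + computability.
  - intros a m. rewrite W_prog_code, thms_race_theory.
    assert (Hz : forall s, eval empty_set c (pr (pr a m) s)
                             (Nat.b2n (negb (entails_in a m s)))).
    { intros s. specialize (Hc (pr (pr a m) s)). cbn beta in Hc.
      repeat (rewrite p1_pr in Hc || rewrite p2_pr in Hc). exact Hc. }
    assert (Hpair : eval empty_set (PPair (const_prog a) id_prog) m (pr a m)).
    { exists a, m. split; [apply eval_const|]. split; [apply eval_id|reflexivity]. }
    split.
    + intros (y & u & Hu & Hy & _).
      rewrite (eval_functional _ _ _ _ _ Hu Hpair) in Hy. exists y.
      pose proof (eval_functional _ _ _ _ _ Hy (Hz y)) as E.
      now destruct (entails_in a m y).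
    + intros Hex. apply least_witness in Hex.
      destruct Hex as (y & Hy & Hlt). exists y, (pr a m).
      split; [exact Hpair|]. split.
      * specialize (Hz y). rewrite Hy in Hz. exact Hz.
      * intros t L. exists 0. specialize (Hz t). rewrite (Hlt t L) in Hz.
        exact Hz.
Qed.

(** * The degree of the theory and of its extensions *)

(** With [W a] as oracle it is decidable whether a stage is settled, so one can be found by
    search. *)
Lemma race_theory_le a :
  (exists x, W a x) -> turing_le (thms (race_theory a)) (W a).
Proof.
  intros Hne.
  destruct (computable_search (W a) (fun m s =>
    ball (fun n => implb (holds (W a (p2 n))) (halts_in a (p2 n) s)) (S m)))
    as (f & Hf & Hsearch).
  - computability.
  - intros m. destruct (settled_exists a m) as [s Hs]. exists s.
    apply ball_true. intros n Hn. rewrite implb_true_iff, holds_true.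
    rewrite <- (halts_in_W a Hne). apply Hs. lia.
  - apply turing_le_decidable with (fun m => entails_in a m (f m)).
    + computability.
    + intros m. split; [apply entails_in_sound|].
      apply entails_in_complete. intros n Hn Hex.
      specialize (Hsearch m). cbn beta in Hsearch.
      rewrite ball_true in Hsearch. specialize (Hsearch n ltac:(lia)).
      rewrite implb_true_iff, holds_true, <- (halts_in_W a Hne) in Hsearch. auto.
Qed.

Lemma re_theory_halts_in V : re_theory V -> exists e, forall n,
  thms V n <-> exists s, halts_in e n s = true.
Proof.
  intros [e He]. exists e. intros n. rewrite <- He. symmetry. apply halts_in_W.
  (* A logical axiom is always a theorem, which gives the nonemptiness that [halts_in_W] asks
     for. *)
  exists (form_code (Imp (Var 0) (Imp (Var 0) (Var 0)))).
  apply He, thms_form_code, pr_k.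
Qed.

Lemma le_extension_race_theory a V :
  (exists x, W a x) -> re_theory V -> consistent V ->
  extends V (race_theory a) -> turing_le (W a) (thms V).
Proof.
  intros Hne HV Hcon Hext. destruct (re_theory_halts_in V HV) as [e He].
  (* The search finds a stage at which [V] has enumerated the variable; it stops at once if [V] does
     not prove it. *)
  destruct (computable_search (thms V) (fun x t =>
    implb (holds (thms V (pr 0 (pr e x)))) (halts_in e (pr 0 (pr e x)) t)))
    as (f & Hf & Hsearch).
  - computability.
  - intros x.
    destruct (classic (thms V (pr 0 (pr e x)))) as [Hx|Hx].
    + apply He in Hx as Hx'. destruct Hx' as [t Ht]. exists t.
      now rewrite Ht, implb_true_r.
    + exists 0. rewrite implb_true_iff, holds_true. tauto.
  - apply turing_le_decidable with (fun x =>
      holds (thms V (pr 0 (pr e x))) && halts_in a x (f x)).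
    + computability.
    + intros x. rewrite andb_true_iff, holds_true, <- (halts_in_W a Hne).
      split; [intros [_ H]; eauto|]. intros [s Hs].
      (* The variable whose race is run against [V] itself, through its own index [e]. *)
      set (n := pr e x) in *.
      assert (Hn : p2 n = x) by apply p2_pr.
      destruct (classic (no_later a n)) as [Hl|Hl].
      * assert (Hx : thms V (pr 0 n)).
        { apply thms_form_code with (p := Var n), Hext, pr_hyp.
          intros v Hv. apply (Hv n s); [now rewrite Hn | exact Hl]. }
        split; [exact Hx|].
        (* At stage [f x] the variable has been enumerated, and [x] was no later. *)
        enough (H : halts_in a (p2 n) (f x) = true) by now rewrite Hn in H.
        apply Hl.
        unfold n at 1. rewrite p1_pr.
        specialize (Hsearch x). cbn beta in Hsearch.
        rewrite implb_true_iff, holds_true in Hsearch. auto.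
      (* The race is lost: [V] has enumerated the variable, yet inherits its negation as an
         axiom. *)
      * exfalso. apply Hcon. exists (Var n). split.
        -- apply thms_form_code, He. apply not_all_ex_not in Hl.
           destruct Hl as [t Ht]. apply imply_to_and in Ht.
           exists t. unfold n in Ht at 1. rewrite p1_pr in Ht. apply Ht.
        -- apply Hext, pr_hyp. intros v Hv. simpl. apply negb_true_iff.
           apply not_true_is_false. intros E. apply Hl.
           apply (Hv n s); [now rewrite Hn | exact E].
Qed.

Lemma race_theory_consistent a : consistent (race_theory a).
Proof.
  intros (p & Hp & Hnp). destruct (respects_exists a) as [v Hv].
  apply race_theory_closed in Hp, Hnp. specialize (Hp v Hv).
  specialize (Hnp v Hv). simpl in Hnp. now rewrite Hp in Hnp.
Qed.

(** * From persistence to incompleteness *)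

(** Search until a formula or its negation, coded by [pr 1 n], is enumerated. Completeness makes the
    search end, and consistency makes its answer correct. *)
Lemma complete_re_theory_recursive V :
  re_theory V -> consistent V -> complete V -> turing_le (thms V) empty_set.
Proof.
  intros HV Hcon Hcomp. destruct (re_theory_halts_in V HV) as [e He].
  destruct (computable_search empty_set (fun n s =>
    implb (is_form n) (halts_in e n s || halts_in e (pr 1 n) s)))
    as (f & Hf & Hsearch).
  - computability.
  - intros n. destruct (is_form n) eqn:E; [|now exists 0].
    apply is_form_true in E. destruct E as [p <-]. simpl.
    destruct (Hcomp p) as [H|H]; apply thms_form_code, He in H;
      destruct H as [s Hs]; exists s.
    + now rewrite Hs.
    + rewrite form_code_Neg in Hs. rewrite Hs. apply orb_true_r.
  - apply turing_le_decidable with (fun n => is_form n && halts_in e n (f n)).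
    + computability.
    + intros n. rewrite andb_true_iff. split.
      * intros [_ H]. apply He. eauto.
      * intros H. assert (Hn : is_form n = true).
        { apply is_form_true. destruct H as (p & E & _). eauto. }
        split; [exact Hn|]. specialize (Hsearch n). cbn beta in Hsearch.
        rewrite Hn in Hsearch. simpl in Hsearch.
        apply orb_true_iff in Hsearch. destruct Hsearch as [Hs|Hs]; [exact Hs|].
        exfalso. destruct H as (p & <- & Hp). apply Hcon. exists p.
        split; [exact Hp|]. apply thms_form_code, He. eauto.
Qed.

Lemma persistent_G1 U :
  turing_persistent U -> ~ turing_le (thms U) empty_set -> G1_holds U.
Proof.
  intros [_ HU] Hnr V HV Hcon Hext Hcomp. apply Hnr.
  apply turing_le_trans with (thms V); [now apply HU|].
  now apply complete_re_theory_recursive.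
Qed.

Lemma turing_equiv_trans A B C :
  turing_equiv A B -> turing_equiv B C -> turing_equiv A C.
Proof.
  intros [H1 H2] [H3 H4]. split; eapply turing_le_trans; eassumption.
Qed.

Lemma turing_le_refl A : turing_le A A.
Proof.
  apply turing_le_decidable with (fun x => holds (A x)); [|intros x; apply holds_true].
  apply decidable_oracle, computable_id.
Qed.

Theorem theorem4p11 :
  exists f : nat -> nat,
    recursive_function f /\
    forall d : nat_set -> Prop,
      re_degree d -> deg_lt deg_zero d -> deg_le d deg_jump_zero ->
      forall e : nat, d (W e) ->
        exists U : theory,
          is_index (f e) U /\
          d (thms U) /\
          turing_persistent U /\
          G1_holds U.
Proof.
  destruct race_theory_index as (f & Hrec & Hidx). exists f.
  split; [exact Hrec|]. intros d [[A HA] _] [_ Hpos] _ e He.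
  (* Being strictly above the zero degree means that no member of [d] is recursive. *)
  assert (Hnr : forall B, d B -> ~ turing_le B empty_set).
  { intros B HB H. apply Hpos. exists B, empty_set. split; [exact HB|].
    split; [|exact H]. split; apply turing_le_refl. }
  assert (Hne : exists x, W e x).
  { apply NNPP. intros Hn. apply (Hnr (W e) He).
    apply turing_le_decidable with (fun _ => false); [apply computable_const|].
    intros x. split; [discriminate|]. intros H. exfalso. eauto. }
  assert (Hre : re_theory (race_theory e)) by (exists (f e); apply Hidx).
  assert (Hd : d (thms (race_theory e))).
  { apply HA. apply turing_equiv_trans with (W e); [|now apply HA].
    split; [now apply race_theory_le|].
    (* The theory is a consistent extension of itself, so the bound for extensions also bounds its
       own degree from below. *)
    apply le_extension_race_theory; try assumption.
    - apply race_theory_consistent.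
    - intros p Hp. exact Hp. }
  assert (Hpers : turing_persistent (race_theory e)).
  { split; [exact Hre|]. intros V HV Hcon Hext.
    apply turing_le_trans with (W e); [now apply race_theory_le|].
    now apply le_extension_race_theory. }
  exists (race_theory e). repeat split; try assumption; try apply Hidx.
  - apply Hpers.
  - apply persistent_G1; [exact Hpers|]. now apply Hnr.
Qed.
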